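(* Let $A=(a_{ij})$ be an $N\times N$ matrix with real entries, let $\epsilon\in\mathbb{R}$, and let $\theta_0=(\theta_1,\dots,\theta_N)\in\mathbb{R}^N$. Suppose that $x_0=e^{\mathbf{i}\theta_0}=(e^{\mathbf{i}\theta_1},\dots,e^{\mathbf{i}\theta_N})^T$ is an eigenvector of $A$ associated with a real eigenvalue $\lambda$. Then $\theta_0$ is an equilibrium point of the complex-valued Kuramoto model with adjacency matrix $A$ and coupling strength $\epsilon$.
   Context: Here $\mathbf{i}=\sqrt{-1}$, and exponentials and arguments of vectors are taken entrywise. The (homogeneous, zero natural frequency) complex-valued Kuramoto model is the system $\frac{d\theta_i}{dt}=\epsilon\sum_{j=1}^N a_{ij}\left[\sin(\theta_j-\theta_i)-\mathbf{i}\cos(\theta_j-\theta_i)\right]$, $1\le i\le N$, with $\theta_i\in\mathbb{C}$; under the substitution $x=e^{\mathbf{i}\theta}$ it becomes the linear system $\frac{dx}{dt}=\epsilon A x$, whose solution is $x(t)=e^{\epsilon tA}x(0)$. A real vector $\theta_0$ is called an equilibrium point of the complex-valued model if, with $x_0=e^{\mathbf{i}\theta_0}$, for all $t\ge 0$ one has $\arg(e^{\epsilon tA}x_0)=\arg(x_0)=\theta_0$, where arguments are understood modulo $2\pi$ (in particular every entry of $e^{\epsilon tA}x_0$ is nonzero). *)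

(* Defs.v *)
From mathcomp Require Import all_boot all_order all_algebra.
From mathcomp Require Import complex.
From mathcomp Require Import all_classical all_reals all_analysis.
Set Implicit Arguments.
Unset Strict Implicit.
Unset Printing Implicit Defensive.
Import Order.TTheory GRing.Theory Num.Theory.
Import numFieldTopology.Exports numFieldNormedType.Exports.
Local Open Scope classical_set_scope.
Local Open Scope ring_scope.
Local Open Scope complex_scope.

(** [e^{i theta}], given by Euler's formula. *)
Definition expi (R : realType) (theta : R) : R[i] := cos theta +i* sin theta.

Definition expi_vec (R : realType) (N : nat) (theta : 'cV[R]_N) : 'cV[R[i]]_N :=
  map_mx (@expi R) theta.

(** Convergence is in the library's topology on ['M[R]_N], which is the
    entrywise one. *)
Definition expmx (R : realType) (N : nat) (A : 'M[R]_N) : 'M[R]_N :=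
  limn (series (fun k : nat => (k`!%:R)^-1 *: A ^+ k)).

Definition complex_mx (R : realType) (m n : nat) (A : 'M[R]_(m, n)) :
    'M[R[i]]_(m, n) :=
  map_mx (real_complex R) A.

(** Eigenvectors are column vectors here, whereas the library's [eigenspace]
    consists of row vectors. *)
Definition col_eigenvector (F : fieldType) (N : nat) (A : 'M[F]_N) (a : F)
    (v : 'cV[F]_N) : Prop :=
  v != 0 /\ A *m v = a *: v.

(** The argument as a multivalued function: [arg z] is the set of all [phi]
    with [z = |z| e^{i phi}], and it is empty for [z = 0]. Arguments are thus
    equal modulo [2 pi] when these sets are equal. *)
Definition arg (R : realType) (z : R[i]) : set R :=
  [set phi : R | z != 0 /\ z = `|z| * expi phi].

Definition mod2pi (R : realType) (theta : R) : set R :=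
  [set phi : R | exists k : int, phi = theta + k%:~R * (2 * pi)].

(** In the variable [x = e^{i theta}] the complex-valued Kuramoto model
    [theta_i' = eps * sum_j a_ij (sin (theta_j - theta_i)
                                  - i cos (theta_j - theta_i))]
    reads [x' = eps A x]; this is its solution at time [t] starting from [x0]. *)
Definition kuramoto_flow (R : realType) (N : nat) (A : 'M[R]_N) (eps : R)
    (x0 : 'cV[R[i]]_N) (t : R) : 'cV[R[i]]_N :=
  complex_mx (expmx ((eps * t) *: A)) *m x0.

Definition kuramoto_equilibrium (R : realType) (N : nat) (A : 'M[R]_N) (eps : R)
    (theta0 : 'cV[R]_N) : Prop :=
  let x0 := expi_vec theta0 in
  forall t : R, 0 <= t -> forall i : 'I_N,
    [/\ kuramoto_flow A eps x0 t i 0 != 0,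
        arg (kuramoto_flow A eps x0 t i 0) = arg (x0 i 0)
      & arg (x0 i 0) = mod2pi (theta0 i 0)].

(* Main.v *)
(** Since [A] and [lambda] are real, the eigenvector equation splits into its
    real and imaginary parts, so [e^{eps t A} x0 = e^{eps t lambda} x0]: the flow
    multiplies [x0] by a positive real number, which preserves arguments. *)

Require Import Defs.
From mathcomp Require Import all_boot all_order all_algebra.
From mathcomp Require Import complex.
From mathcomp Require Import all_classical all_reals all_analysis.
From mathcomp Require Import lra.
Import Order.TTheory GRing.Theory Num.Theory.
Import numFieldTopology.Exports numFieldNormedType.Exports.
Local Open Scope classical_set_scope.
Local Open Scope ring_scope.
Local Open Scope complex_scope.

Lemma periodicz {U V : zmodType} {f : U -> V} {T : U} :
  periodic f T -> forall (k : int) (a : U), f (a + T *~ k) = f a.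
Proof.
move=> fT [n|n] a; first exact: periodicn.
(* For a negative multiple, adding back [n.+1] periods leaves [f] unchanged and returns the point to
   [a]. *)
by rewrite -[LHS](periodicn fT n.+1) NegzE mulrNz subrK.
Qed.

(** Reduce [x] modulo [2 * pi] to [y] in [0, 2 pi), then use injectivity of the cosine on [0, pi],
    applied to [y] or to its reflection [2 * pi - y]. *)
Lemma cos_eq1 {R : realType} {x : R} :
  cos x = 1 -> exists k : int, x = k%:~R * (2 * pi).
Proof.
move=> cosx1.
have p0 := @pi_gt0 R.
pose k := Num.floor (x / (2 * pi)); exists k.
pose y := x - k%:~R * (2 * pi).
have y_ge0 : 0 <= y.
  by rewrite subr_ge0 -ler_pdivlMr ?mulr_gt0// floor_le.
have y_lt : y < 2 * pi.
  rewrite ltrBlDr -[X in X + _]mul1r -mulrDl addrC -ltr_pdivrMr ?mulr_gt0//.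
  by have /andP[_] := floor_itv (x / (2 * pi)); rewrite intrD.
have cosy1 : cos y = 1.
  rewrite -cosx1 -(periodicz (@cosD2pi R) k y) /y; congr cos.
  by rewrite -[pi *+ 2 *~ k]mulrzl -[pi *+ 2]mulr_natl subrK.
have [y_le|y_gt] := leP y pi.
  have /eqP : y = 0.
    by apply: cos_inj; rewrite ?in_itv/= ?cos0 ?lexx ?y_ge0 ?(ltW p0).
  by rewrite subr_eq0 => /eqP.
(* Beyond [pi] the reflected point would have to be 0, so [y] would equal [2 * pi], contradicting
   [y_lt]. *)
have : 2 * pi - y = 0.
  apply: cos_inj; rewrite ?in_itv/= ?lexx ?(ltW p0) //.
    by apply/andP; split; lra.
  by rewrite cos0 -[RHS]cosy1 -[RHS]cosN addrC mulr_natl cosD2pi.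
lra.
Qed.

Lemma normc_expi {R : realType} (theta : R) : `|expi theta| = 1.
Proof. by rewrite /expi normc_def /= cos2Dsin2 sqrtr1. Qed.

Lemma expi_neq0 {R : realType} (theta : R) : expi theta != 0.
Proof. by rewrite -normr_eq0 normc_expi oner_neq0. Qed.

Lemma arg_expi {R : realType} (theta : R) : arg (expi theta) = mod2pi theta.
Proof.
apply/seteqP; split=> phi /=.
  move=> [_]; rewrite normc_expi mul1r => -[cosE sinE].
  (* The two angles share cosine and sine, so the subtraction formula yields cos^2 + sin^2. *)
  have /cos_eq1[k kE] : cos (phi - theta) = 1.
    by rewrite cosB cosE sinE -!expr2 cos2Dsin2.
  by exists k; rewrite -kE addrC subrK.
move=> [k ->]; split; first exact: expi_neq0.
rewrite normc_expi mul1r /expi mulrzl mulr_natl.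
by rewrite (periodicz (@cosD2pi R)) (periodicz (@sinD2pi R)).
Qed.

(** A positive real is its own modulus, so [r] cancels from both sides of the equation z = |z| e^{i
    phi}. *)
Lemma arg_pMl {R : realType} {r : R} (z : R[i]) :
  0 < r -> arg (r%:C * z) = arg z.
Proof.
move=> r_gt0.
have r0 : r%:C != 0 by rewrite fmorph_eq0 gt_eqF.
apply/seteqP; split=> phi /= [z0 zE].
  have z0' : z != 0 by move: z0; rewrite mulf_eq0 negb_or => /andP[].
  split=> //; apply: (mulfI r0); rewrite {}zE normrM -mulrA.
  by rewrite ger0_norm // lecR ltW.
split; first by rewrite mulf_neq0.
by rewrite {1}zE normrM -mulrA; rewrite [`|r%:C|]ger0_norm // lecR ltW.
Qed.

(** A matrix entourage is controlled by one entourage per entry, and a filter is closed under the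
    finite intersection over all entries. *)
Lemma cvg_mx {T : puniformType} {m n : nat} {I : Type} {F : set_system I}
    {FF : Filter F} (u : I -> 'M[T]_(m, n)) (L : 'M[T]_(m, n)) :
  (forall i j, u k i j @[k --> F] --> L i j) -> u k @[k --> F] --> L.
Proof.
move=> uL; apply/cvg_mx_entourageP => A entA.
apply: filter_forall => i; apply: filter_forall => j.
rewrite near_simpl.
by have /cvg_app_entourageP/(_ _ entA) := uL i j; apply: filterS => k /mem_set.
Qed.

(** This geometric bound lets the scalar exponential series dominate every entry of the matrix one.
    In the induction, expanding the product leaves the absolute sum of row [i], which is at most the
    sum over all entries. *)
Lemma normr_exprmx_le {R : realType} {N : nat} (A : 'M[R]_N) (k : nat) i j :
  `|(A ^+ k) i j| <= (\sum_a \sum_b `|A a b|) ^+ k.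
Proof.
elim: k i j => [|k IHk] i j.
  by rewrite !expr0 mxE; case: eqP; rewrite ?normr1 ?normr0.
rewrite !exprS mxE (le_trans (ler_norm_sum _ _ _)) //.
apply: (@le_trans _ _ ((\sum_b `|A i b|) * (\sum_a \sum_b `|A a b|) ^+ k)).
  by rewrite mulr_suml; apply: ler_sum => l _; rewrite normrM ler_wpM2l.
apply: ler_wpM2r; first by rewrite exprn_ge0 // !sumr_ge0 // => *; rewrite sumr_ge0.
rewrite [leRHS](bigD1 i) //= lerDl sumr_ge0 // => a _; exact: sumr_ge0.
Qed.

Lemma series_mxE {R : realType} {m n : nat} (u : nat -> 'M[R]_(m, n)) k i j :
  series u k i j = series (fun l => u l i j) k.
Proof. by rewrite /series /= summxE. Qed.

Lemma is_cvg_series_expmx {R : realType} {N : nat} (A : 'M[R]_N) i j :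
  cvgn (series (fun k => ((k`!%:R)^-1 *: A ^+ k) i j)).
Proof.
apply: normed_cvg.
apply: series_le_cvg (is_cvg_series_exp_coeff (\sum_a \sum_b `|A a b|)) => k //=.
  by rewrite exp_coeff_ge0 // sumr_ge0 // => a _; exact: sumr_ge0.
rewrite mxE normrM ger0_norm ?invr_ge0// /exp_coeff /= mulrC.
by rewrite ler_wpM2r ?invr_ge0 // normr_exprmx_le.
Qed.

Lemma expmxE {R : realType} {N : nat} (A : 'M[R]_N) i j :
  expmx A i j = limn (series (fun k => ((k`!%:R)^-1 *: A ^+ k) i j)).
Proof.
pose L := \matrix_(a, b) limn (series (fun k => ((k`!%:R)^-1 *: A ^+ k) a b)).
(* The matrix of entrywise limits is the limit of the matrix series, and limits are unique in a
   Hausdorff space. *)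
suff -> : expmx A = L by rewrite mxE.
apply: cvg_lim; first exact: norm_hausdorff.
apply: cvg_mx => a b; rewrite mxE.
under eq_fun do rewrite series_mxE.
exact: is_cvg_series_expmx.
Qed.

Lemma exprmx_eigen {F : fieldType} {N : nat} {A : 'M[F]_N} {mu : F}
    {v : 'cV[F]_N} (k : nat) :
  A *m v = mu *: v -> A ^+ k *m v = mu ^+ k *: v.
Proof.
move=> Av; elim: k => [|k IHk]; first by rewrite !expr0 mul1mx scale1r.
by rewrite !exprS -mulmxA IHk -scalemxAr Av scalerA mulrC.
Qed.

(** On [v] each power of [A] acts as the same power of [mu], so the partial sums of both
    exponentials agree on [v]; pass to the limit. Here [v] may be zero, as can happen to the real or
    imaginary part of an eigenvector. *)
Lemma expmx_eigen {R : realType} {N : nat} {A : 'M[R]_N} {mu : R}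
    {v : 'cV[R]_N} :
  A *m v = mu *: v -> expmx A *m v = expR mu *: v.
Proof.
move=> Av; apply/matrixP => i j; rewrite !mxE.
have cvgE : \sum_l series (fun k => ((k`!%:R)^-1 *: A ^+ k) i l) n * v l j
    @[n --> \oo] --> \sum_l expmx A i l * v l j.
  apply: cvg_big => [|l _]; first exact: add_continuous.
  apply: cvgMl; rewrite expmxE.
  exact: is_cvg_series_expmx.
have cvgR : series (exp_coeff mu) n * v i j @[n --> \oo] --> expR mu * v i j.
  by apply: cvgMl; exact: is_cvg_series_exp_coeff.
apply: (cvg_unique _ cvgE); first exact: norm_hausdorff.
suff -> : (fun n => \sum_l series (fun k => ((k`!%:R)^-1 *: A ^+ k) i l) n * v l j)
  = (fun n => series (exp_coeff mu) n * v i j) by [].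
apply/funext => n; rewrite /series /= mulr_suml.
under eq_bigr do rewrite mulr_suml.
(* With the sum over the powers outermost, the inner sum over [l] is an entry of [A ^+ k *m v]. *)
rewrite exchange_big /=; apply: eq_bigr => k _.
have /matrixP/(_ i j) := exprmx_eigen k Av; rewrite !mxE /exp_coeff /= => AvE.
under eq_bigr do rewrite mxE -mulrA.
by rewrite -mulr_sumr AvE mulrA [_^-1 * _]mulrC.
Qed.

(** A real matrix does not mix real and imaginary parts. This is used both for [A] and for its
    exponential, so that the analysis stays over the reals. *)
Lemma complex_mxM_complex {R : realType} {m n p : nat} (A : 'M[R]_(m, n))
    (X Y : 'M[R]_(n, p)) i j :
  (complex_mx A *m \matrix_(k, l) (X k l +i* Y k l)) i j =
  (A *m X) i j +i* (A *m Y) i j.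
Proof.
rewrite !mxE; elim/big_rec3: _ => //= k x y z _ ->.
by rewrite !mxE; simpc.
Qed.

Theorem proposition1 (R : realType) (N : nat) (A : 'M[R]_N) (eps : R)
    (theta0 : 'cV[R]_N) (lambda : R)
    (x0_eigen : col_eigenvector (complex_mx A) (lambda%:C)
                                (expi_vec theta0)) :
  kuramoto_equilibrium A eps theta0.
Proof.
case: x0_eigen => _ Ax0 x0 t _ i; rewrite {}/x0.
pose X := map_mx (@cos R) theta0; pose Y := map_mx (@sin R) theta0.
have x0E : expi_vec theta0 = \matrix_(k, l) (X k l +i* Y k l).
  by apply/matrixP => k l; rewrite !mxE.
have [AX AY] : A *m X = lambda *: X /\ A *m Y = lambda *: Y.
  split; apply/matrixP => k l; move/matrixP: Ax0 => /(_ k l);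
  rewrite {1}x0E complex_mxM_complex !mxE /expi; simpc; by case.
pose mu := eps * t * lambda.
have EX : expmx ((eps * t) *: A) *m X = expR mu *: X.
  by apply: expmx_eigen; rewrite -scalemxAl AX scalerA.
have EY : expmx ((eps * t) *: A) *m Y = expR mu *: Y.
  by apply: expmx_eigen; rewrite -scalemxAl AY scalerA.
have flowE : kuramoto_flow A eps (expi_vec theta0) t i 0 =
    (expR mu)%:C * expi (theta0 i 0).
  by rewrite /kuramoto_flow x0E complex_mxM_complex EX EY !mxE /expi; simpc.
rewrite flowE [expi_vec _ _ _]mxE; split.
- by rewrite mulf_neq0 ?expi_neq0 // fmorph_eq0 gt_eqF ?expR_gt0.
- by rewrite arg_pMl ?expR_gt0.
- exact: arg_expi.
Qed.
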